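(* Let $n\ge3$. Define $\psi:A_{n-1}^*\to C_n^*$ by $\psi(\varepsilon)=\varepsilon$ (empty word) and $\psi(w)=w\,n\,\bar n\,n\,\bar n$ for nonempty $w\in A_{n-1}^*$ (regarding $A_{n-1}=\{1,\dots,n-1\}\subseteq C_n$). Then $\psi$ induces (via $[w]\mapsto[\psi(w)]$) a well-defined injective monoid homomorphism from $\mathrm{hypo}(\mathcal{A}_{n-1})=A_{n-1}^*/\ddot{\sim}_{\mathcal{A}}$ to $\mathrm{hypo}(\mathcal{C}_n)=C_n^*/\ddot{\sim}_{\mathcal{C}}$.
   Context: $|w|_a$ denotes the number of occurrences of the letter $a$ in the word $w$. Type $\mathfrak{A}_{n-1}$: $A_{n-1}=\{1<\cdots<n-1\}$, index set $\{1,\dots,n-2\}$. Structure on $A_{n-1}^*$: $\mathrm{wt}(w)=(|w|_1,\dots,|w|_{n-1})$. For $i\in\{1,\dots,n-2\}$, $w$ has an $i$-inversion if $w=w_1\,i\,w_2\,(i+1)\,w_3$; then $\ddot{\varepsilon}_i(w)=\ddot{\varphi}_i(w)=+\infty$ and $\ddot{e}_i(w),\ddot{f}_i(w)$ are undefined; otherwise $\ddot{\varepsilon}_i(w)=|w|_{i+1}$, $\ddot{\varphi}_i(w)=|w|_i$, $\ddot{e}_i(w)$ is defined iff $|w|_{i+1}>0$ (replace the right-most $i+1$ by $i$), and $\ddot{f}_i(w)$ is defined iff $|w|_i>0$ (replace the left-most $i$ by $i+1$). Type $\mathfrak{C}_n$: $C_n=\{1<\cdots<n<\bar n<\overline{n-1}<\cdots<\bar1\}$,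 index set $\{1,\dots,n\}$; the symbols $n+1,\overline{n+1}$ never occur. $w$ has an $i$-inversion if $w=w_1xw_2yw_3$ with $x\in\{i,\overline{i+1}\}$, $y\in\{i+1,\bar i\}$. Structure on $C_n^*$: $\mathrm{wt}(w)=(|w|_1-|w|_{\bar1},\dots,|w|_n-|w|_{\bar n})$; if $w$ has an $i$-inversion then $\ddot{\varepsilon}_i(w)=\ddot{\varphi}_i(w)=+\infty$ and $\ddot{e}_i,\ddot{f}_i$ are undefined on $w$; otherwise $\ddot{\varepsilon}_i(w)=|w|_{i+1}+|w|_{\bar i}$, $\ddot{\varphi}_i(w)=|w|_i+|w|_{\overline{i+1}}$, $\ddot{e}_i(w)$ (defined iff $\ddot{\varepsilon}_i(w)>0$) replaces the right-most letter in $\{i+1,\bar i\}$ by its image ($i+1\mapsto i$, $\bar i\mapsto\overline{i+1}$ for $i<n$; $\bar n\mapsto n$), and $\ddot{f}_i(w)$ (defined iff $\ddot{\varphi}_i(w)>0$) replaces the left-most letter in $\{i,\overline{i+1}\}$ by its image ($i\mapsto i+1$, $\overline{i+1}\mapsto\bar i$ for $i<n$; $n\mapsto\bar n$). In either type, the connected component of a word $w$ is the set of words obtained from $w$ by finitely many (defined) applications of the operators $\ddot{e}_i,\ddot{f}_i$ of that type, and the hypoplactic congruence is: $u\ddot{\sim}v$ iff there is a bijection $\psi$ from the component of $u$ onto the component of $v$ with $\psi(u)=v$, preserving $\mathrm{wt},\ddot{\varepsilon}_i,\ddot{\varphi}_i$, and such that $\ddot{e}_i(\psi(x))$ is defined iff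 $\ddot{e}_i(x)$ is (then $\psi(\ddot{e}_i(x))=\ddot{e}_i(\psi(x))$), likewise for $\ddot{f}_i$. It is a monoid congruence; $\ddot{\sim}_{\mathcal{A}}$ and $\ddot{\sim}_{\mathcal{C}}$ denote it on $A_{n-1}^*$ and $C_n^*$ respectively. *)

(* Defs.v *)
From HB Require Import structures.
From mathcomp Require Import all_boot all_order all_algebra.
From mathcomp Require Import mathcomp_extra boolp classical_sets functions.
Set Implicit Arguments.
Unset Strict Implicit.
Unset Printing Implicit Defensive.
Import GRing.Theory.

(* Data determining a quasi-crystal structure on the words over an alphabet.
   [raise i x = Some y] (resp. [lower i x = Some y]) means that e_i (resp. f_i)
   may rewrite an occurrence of the letter [x] into [y]. *)
Record crystal_data := CrystalData {
  letter : choiceType;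
  index : Type;
  weight : zmodType;
  wt : seq letter -> weight;
  wt_cat : forall u v, wt (u ++ v) = (wt u + wt v)%R;
  raise : index -> letter -> option letter;
  lower : index -> letter -> option letter
}.

Section Words.
Context {X : Type}.
Implicit Types (g : X -> option X) (w : seq X).

Fixpoint rewrite_first g w : option (seq X) :=
  if w is x :: w' then
    if g x is Some y then Some (y :: w') else omap (cons x) (rewrite_first g w')
  else None.

Fixpoint rewrite_last g w : option (seq X) :=
  if w is x :: w' then
    if rewrite_last g w' is Some w'' then Some (x :: w'')
    else omap (fun y => y :: w') (g x)
  else None.

Lemma rewrite_first_cat g u v :
  rewrite_first g (u ++ v) =
  if has (isSome \o g) u then omap (cat^~ v) (rewrite_first g u)
  else omap (cat u) (rewrite_first g v).
Proof.
elim: u => [|x u IH] /=; first by case: rewrite_first.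
case: (g x) => [y|] //=; rewrite IH; case: ifP => _.
  by case: rewrite_first.
by case: (rewrite_first g v).
Qed.

Lemma rewrite_last_none g w :
  ~~ has (isSome \o g) w -> rewrite_last g w = None.
Proof. by elim: w => //= x w IH; case: (g x) => //= /IH ->. Qed.

Lemma rewrite_last_some g w :
  has (isSome \o g) w -> isSome (rewrite_last g w).
Proof.
elim: w => //= x w IH; case: (boolP (has _ w)) => [/IH|_].
  by case: rewrite_last.
by rewrite orbF; case: (g x) => //= y; case: rewrite_last.
Qed.

Lemma rewrite_last_cat g u v :
  rewrite_last g (u ++ v) =
  if has (isSome \o g) v then omap (cat u) (rewrite_last g v)
  else omap (cat^~ v) (rewrite_last g u).
Proof.
elim: u => [|x u IH] /=.
  case: ifP => [_|/negbT /rewrite_last_none ->//].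
  by case: rewrite_last.
rewrite IH; case: ifP => [/rewrite_last_some|_].
  by case: rewrite_last.
by case: rewrite_last => //=; case: (g x).
Qed.

Lemma size_rewrite_first g w w' :
  rewrite_first g w = Some w' -> size w' = size w.
Proof.
elim: w w' => //= x w IH w'; case: (g x) => [y [<-]//|].
by case: rewrite_first IH => //= a IH [<-] /=; rewrite (IH a).
Qed.

Lemma size_rewrite_last g w w' :
  rewrite_last g w = Some w' -> size w' = size w.
Proof.
elim: w w' => //= x w IH w'; case: rewrite_last IH => [a|] IH /=.
  by case=> <-; rewrite /= (IH a).
by case: (g x) => //= y [<-].
Qed.

End Words.

Section QuasiCrystal.
Context {Q : crystal_data}.
Local Notation X := (letter Q).
Local Notation word := (seq (letter Q)).
Implicit Types (i : index Q) (u v w x y : word).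

Definition is_e i (a : X) : bool := isSome (raise i a).
Definition is_f i (a : X) : bool := isSome (lower i a).

(* Some letter on which f_i acts occurs before some letter on which e_i acts;
   see [inversionP]. *)
Definition inversion i w : bool :=
  ~~ pairwise (fun a b => ~~ (is_f i a && is_e i b)) w.

Lemma inversionP i w :
  reflect (exists w1 a w2 b w3,
             [/\ w = w1 ++ a :: w2 ++ b :: w3, is_f i a & is_e i b])
          (inversion i w).
Proof.
rewrite /inversion; apply: (iffP idP) => [|[w1 [a [w2 [b [w3 [-> fa eb]]]]]]].
  elim: w => //= a w IH; rewrite negb_and => /orP[|/IH].
    case/allPn => b /splitPr[w2 w3]; rewrite negbK => /andP[fa eb].
    by exists [::], a, w2, b, w3.
  move=> [w1 [a' [w2 [b [w3 [-> fa eb]]]]]].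
  by exists (a :: w1), a', w2, b, w3.
by rewrite pairwise_cat /= all_cat /= fa eb /= !andbF.
Qed.

(* [None] stands for +oo. *)
Definition eps i w : option nat :=
  if inversion i w then None else Some (count (is_e i) w).
Definition phi i w : option nat :=
  if inversion i w then None else Some (count (is_f i) w).

(* [None] stands for undefined. *)
Definition e_op i w : option word :=
  if inversion i w then None else rewrite_last (raise i) w.
Definition f_op i w : option word :=
  if inversion i w then None else rewrite_first (lower i) w.

Inductive component u : word -> Prop :=
| component_refl : component u u
| component_e i x y : component u x -> e_op i x = Some y -> component u y
| component_f i x y : component u x -> f_op i x = Some y -> component u y.

Definition hypoplactic u v : Prop :=
  exists h : word -> word,
    [/\ set_bij (component u) (component v) h, h u = v &
        forall x, component u x ->
          wt (h x) = wt x /\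
          forall i, [/\ eps i (h x) = eps i x, phi i (h x) = phi i x,
                        e_op i (h x) = omap h (e_op i x) &
                        f_op i (h x) = omap h (f_op i x)]].

Lemma hypoplactic_refl u : hypoplactic u u.
Proof.
exists id; split=> //; first by split=> // x; exists x.
move=> x _; split=> // i; split=> //; first by case: e_op.
by case: f_op.
Qed.

Lemma hypoplactic_trans v u w :
  hypoplactic u v -> hypoplactic v w -> hypoplactic u w.
Proof.
move=> [h [hb hu hP]] [k [kb kv kP]]; exists (k \o h); split.
- exact: set_bij_comp hb kb.
- by rewrite /= hu.
move=> x ux; have vhx := set_bij_homo hb ux.
have [wx xP] := hP x ux; have [wkx hxP] := kP _ vhx.
split=> [|i] /=; first by rewrite wkx.
have [<- <- ee ff] := xP i; have [-> -> -> ->] := hxP i.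
by rewrite ee ff; split=> //; [case: e_op|case: f_op].
Qed.

Lemma hypoplactic_sym u v : hypoplactic u v -> hypoplactic v u.
Proof.
move=> [h [hb hu hP]].
have hI : {in (component u : set word) &, injective h} := set_bij_inj hb.
have hS y : {x | component v y -> component u x /\ h x = y}.
  apply: cid; have [vy|nvy] := pselect (component v y); last by exists y.
  by have [x ux xy] := set_bij_surj hb vy; exists x.
pose k y := sval (hS y).
have kP y : component v y -> component u (k y) /\ h (k y) = y.
  exact: (svalP (hS y)).
have hk x : component u x -> k (h x) = x.
  move=> ux; have [uk kh] := kP _ (set_bij_homo hb ux).
  by apply: hI; rewrite ?inE.
exists k; split.
- split.
  + by move=> y /kP[].
  + by move=> y z; rewrite !inE => /kP[_ {2}<-] /kP[_ {2}<-] ->.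
  + by move=> x ux; exists (h x); [exact: (set_bij_homo hb)|exact: hk].
- by rewrite -hu hk //; apply: component_refl.
move=> y vy; have [uky hky] := kP y vy; have [wE iP] := hP _ uky.
rewrite hky in wE iP; split=> // i; have [-> -> -> ->] := iP i; split=> //.
  case E : (e_op i (k y)) => [z|] //=; rewrite hk //.
  exact: component_e uky E.
case E : (f_op i (k y)) => [z|] //=; rewrite hk //.
exact: component_f uky E.
Qed.

Lemma size_component u x : component u x -> size x = size u.
Proof.
elim=> // i a b _ <-; rewrite /e_op /f_op; case: ifP => // _.
  exact: size_rewrite_last.
exact: size_rewrite_first.
Qed.

Lemma inversion_cat i u v :
  inversion i (u ++ v) =
  [|| inversion i u, inversion i v | has (is_f i) u && has (is_e i) v].
Proof.
rewrite /inversion pairwise_cat !negb_and orbC -orbA; congr (_ || (_ || _)).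
elim: u => //= a u IH; rewrite allrel_consl negb_and IH.
case: (is_f i a) => /=; last by rewrite all_predT.
by rewrite -has_predC (eq_has (a2 := is_e i)) => [|b]/=; rewrite ?negbK //;
  case: has => //=; rewrite andbF.
Qed.

Lemma e_op_cat i u v :
  e_op i (u ++ v) =
  if inversion i (u ++ v) then None
  else if has (is_e i) v then omap (cat u) (e_op i v)
  else omap (cat^~ v) (e_op i u).
Proof.
rewrite /e_op; case: ifP => //; rewrite inversion_cat.
by case: (inversion i u) => //=; case: (inversion i v) => //= _;
  rewrite rewrite_last_cat.
Qed.

Lemma f_op_cat i u v :
  f_op i (u ++ v) =
  if inversion i (u ++ v) then None
  else if has (is_f i) u then omap (cat^~ v) (f_op i u)
  else omap (cat u) (f_op i v).
Proof.
rewrite /f_op; case: ifP => //; rewrite inversion_cat.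
by case: (inversion i u) => //=; case: (inversion i v) => //= _;
  rewrite rewrite_first_cat.
Qed.

Lemma component_cat u v x : component (u ++ v) x ->
  component u (take (size u) x) /\ component v (drop (size u) x).
Proof.
elim=> [|i a b ab [ca cb]|i a b ab [ca cb]].
- by rewrite take_size_cat // drop_size_cat //; split; apply: component_refl.
- have sa := size_component ca; rewrite -{1}(cat_take_drop (size u) a) e_op_cat.
  case: ifP => // _; case: ifP => _.
    case E: e_op => [z|] //= [<-].
    by rewrite take_size_cat // drop_size_cat //; split=> //;
      apply: component_e cb E.
  case E: e_op => [z|] //= [<-].
  have cz : component u z by apply: component_e ca E.
  have sz := size_component cz.
  by rewrite take_size_cat // drop_size_cat.
- have sa := size_component ca; rewrite -{1}(cat_take_drop (size u) a) f_op_cat.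
  case: ifP => // _; case: ifP => _; last first.
    case E: f_op => [z|] //= [<-].
    by rewrite take_size_cat // drop_size_cat //; split=> //;
      apply: component_f cb E.
  case E: f_op => [z|] //= [<-].
  have cz : component u z by apply: component_f ca E.
  have sz := size_component cz.
  by rewrite take_size_cat // drop_size_cat.
Qed.

Lemma eq_inversion i x y : eps i x = eps i y -> inversion i x = inversion i y.
Proof. by rewrite /eps; do 2 case: ifP. Qed.

Lemma eq_has_e i x y : eps i x = eps i y -> ~~ inversion i y ->
  has (is_e i) x = has (is_e i) y.
Proof. by rewrite /eps !has_count; do 2 case: ifP => //; move=> _ _ [->]. Qed.

Lemma eq_has_f i x y : phi i x = phi i y -> ~~ inversion i y ->
  has (is_f i) x = has (is_f i) y.
Proof. by rewrite /phi !has_count; do 2 case: ifP => //; move=> _ _ [->]. Qed.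

Lemma hypoplactic_cat u u' v v' :
  hypoplactic u u' -> hypoplactic v v' -> hypoplactic (u ++ v) (u' ++ v').
Proof.
move=> [h [hb hu hP]] [k [kb kv kP]].
pose m x := h (take (size u) x) ++ k (drop (size u) x).
have mE a b : component u a -> m (a ++ b) = h a ++ k b.
  by move=> /size_component sa; rewrite /m take_size_cat ?drop_size_cat.
have main a b : component u a -> component v b ->
  wt (m (a ++ b)) = wt (a ++ b) /\
  forall i, [/\ eps i (m (a ++ b)) = eps i (a ++ b),
    phi i (m (a ++ b)) = phi i (a ++ b),
    e_op i (m (a ++ b)) = omap m (e_op i (a ++ b)) &
    f_op i (m (a ++ b)) = omap m (f_op i (a ++ b))].
  move=> ua vb; rewrite mE //; have [wa iA] := hP a ua; have [wb iB] := kP b vb.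
  rewrite !wt_cat wa wb; split=> // i.
  have [ea fa eea ffa] := iA i; have [eb fb eeb ffb] := iB i.
  have invE : inversion i (h a ++ k b) = inversion i (a ++ b).
    rewrite !inversion_cat (eq_inversion ea) (eq_inversion eb).
    case: (boolP (inversion i a)) => //= na.
    case: (boolP (inversion i b)) => //= nb.
    by rewrite (eq_has_f fa na) (eq_has_e eb nb).
  rewrite /eps /phi e_op_cat f_op_cat invE e_op_cat f_op_cat.
  case: ifP => // /negbT; rewrite inversion_cat !negb_or => /and3P[na nb _].
  rewrite (eq_has_f fa na) (eq_has_e eb nb) !count_cat.
  have iha := eq_inversion ea; have ikb := eq_inversion eb.
  move: ea eb fa fb; rewrite /eps /phi iha ikb (negbTE na) (negbTE nb).
  move=> [->] [->] [->] [->]; rewrite eea eeb ffa ffb; split=> //.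
    case: ifP => _; first by case: (e_op i b) => //= z; rewrite mE.
    case E: (e_op i a) => [z|] //=; rewrite mE //; exact: component_e ua E.
  case: ifP => _; last by case: (f_op i b) => //= z; rewrite mE.
  case E: (f_op i a) => [z|] //=; rewrite mE //; exact: component_f ua E.
have mainx x : component (u ++ v) x -> wt (m x) = wt x /\
  forall i, [/\ eps i (m x) = eps i x, phi i (m x) = phi i x,
    e_op i (m x) = omap m (e_op i x) & f_op i (m x) = omap m (f_op i x)].
  move=> /component_cat[ca cb].
  by have := main _ _ ca cb; rewrite cat_take_drop.
have m0 : m (u ++ v) = u' ++ v' by rewrite mE ?hu ?kv //; apply: component_refl.
exists m; split=> //; split.
- move=> x; elim=> [|i a b ab cm E|i a b ab cm E].
    by rewrite m0; apply: component_refl.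
    have [_ /(_ i)[_ _ ee _]] := mainx a ab.
    by apply: (component_e (i := i) cm); rewrite ee E.
  have [_ /(_ i)[_ _ _ ff]] := mainx a ab.
  by apply: (component_f (i := i) cm); rewrite ff E.
- move=> x y; rewrite !inE => /component_cat[xa xb] /component_cat[ya yb].
  have sz c : component u c -> size (h c) = size u'.
    by move=> /(set_bij_homo hb)/size_component.
  move=> /eqP; rewrite /m eqseq_cat ?sz // => /andP[/eqP E1 /eqP E2].
  rewrite -(cat_take_drop (size u) x) -(cat_take_drop (size u) y).
  by congr (_ ++ _); [apply: (set_bij_inj hb)|apply: (set_bij_inj kb)];
    rewrite ?inE.
- move=> y; elim=> [|i a b _ [x xc <-] E|i a b _ [x xc <-] E].
  + by exists (u ++ v) => //; apply: component_refl.
  + move: E; have [_ /(_ i)[_ _ -> _]] := mainx x xc.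
    case E: e_op => [z|] //= [<-]; exists z => //; exact: component_e xc E.
  + move: E; have [_ /(_ i)[_ _ _ ->]] := mainx x xc.
    case E: f_op => [z|] //= [<-]; exists z => //; exact: component_f xc E.
Qed.

End QuasiCrystal.

Section HypoplacticMonoid.
Context (Q : crystal_data).
Local Notation word := (seq (letter Q)).

Definition hypoplacticb : rel word := fun u v => `[< hypoplactic u v >].

Lemma hypoplacticb_equiv : equiv_class_of hypoplacticb.
Proof.
split.
- by move=> u; apply/asboolP/hypoplactic_refl.
- by move=> u v; apply/asboolP/asboolP; apply: hypoplactic_sym.
- by move=> v u w /asboolP uv /asboolP vw; apply/asboolP/(hypoplactic_trans uv).
Qed.

Canonical hypoplactic_equiv := EquivRelPack hypoplacticb_equiv.

Definition hypo := {eq_quot hypoplactic_equiv}%qT.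
HB.instance Definition _ := EqQuotient.on hypo.
HB.instance Definition _ := Choice.on hypo.

Definition hypo_class (w : word) : hypo := (\pi_hypo w)%qT.

Lemma hypo_classP u v : hypo_class u = hypo_class v <-> hypoplactic u v.
Proof.
split=> [|uv]; first by move=> /eqP; rewrite eqmodE => /asboolP.
by apply/eqP; rewrite eqmodE; apply/asboolP.
Qed.

Lemma hypo_class_repr (x : hypo) : hypo_class (repr x) = x.
Proof. exact: reprK. Qed.

Definition hypo_mul (x y : hypo) : hypo := hypo_class (repr x ++ repr y).
Definition hypo_one : hypo := hypo_class [::].

Lemma hypo_class_cat u v :
  hypo_class (u ++ v) = hypo_mul (hypo_class u) (hypo_class v).
Proof.
apply/hypo_classP; apply: hypoplactic_cat;
  by apply/hypo_classP; rewrite hypo_class_repr.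
Qed.

Lemma hypo_mulA : associative hypo_mul.
Proof.
move=> x y z; rewrite -(hypo_class_repr x) -(hypo_class_repr y).
by rewrite -(hypo_class_repr z) -!hypo_class_cat catA.
Qed.

Lemma hypo_mul1 : left_id hypo_one hypo_mul.
Proof. by move=> x; rewrite -(hypo_class_repr x) -hypo_class_cat. Qed.

Lemma hypo_1mul : right_id hypo_one hypo_mul.
Proof. by move=> x; rewrite -(hypo_class_repr x) -hypo_class_cat cats0. Qed.

HB.instance Definition _ := isMonoid.Build hypo hypo_mulA hypo_mul1 hypo_1mul.

End HypoplacticMonoid.

(* Type A with alphabet {1 < ... < m}; the ordinal [k : 'I_m] is the letter
   k + 1 and the ordinal [i : 'I_m.-1] is the index i + 1. *)
Section TypeA.
Context (m : nat).

Definition wtA (w : seq 'I_m) : {ffun 'I_m -> int} :=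
  [ffun k => Posz (count_mem k w)].

Lemma wtA_cat u v : wtA (u ++ v) = (wtA u + wtA v)%R.
Proof. by apply/ffunP => k; rewrite !ffunE count_cat. Qed.

Definition raiseA (i : 'I_m.-1) (x : 'I_m) : option 'I_m :=
  if x == i.+1 :> nat then insub (i : nat) else None.
Definition lowerA (i : 'I_m.-1) (x : 'I_m) : option 'I_m :=
  if x == i :> nat then insub i.+1 else None.

Definition typeA := CrystalData wtA_cat raiseA lowerA.

End TypeA.

(* Type C of rank n; the ordinal [k : 'I_n] encodes k + 1, [inl] being the
   unbarred letters and [inr] the barred ones. The index [i : 'I_n] is i + 1,
   and the letters n + 1 and its bar are excluded because [insub n] is [None]
   in ['I_n]. The partial maps are
   e_i : i+1 -> i, bar i -> bar (i+1) for i < n; bar n -> n for i = n;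
   f_i : the inverse partial map. *)
Section TypeC.
Context (n : nat).

Definition letterC := ('I_n + 'I_n)%type.

Definition wtC (w : seq letterC) : {ffun 'I_n -> int} :=
  [ffun k => Posz (count_mem (inl k) w) - Posz (count_mem (inr k) w)]%R.

Lemma wtC_cat u v : wtC (u ++ v) = (wtC u + wtC v)%R.
Proof.
by apply/ffunP => k; rewrite !ffunE !count_cat !PoszD opprD addrACA.
Qed.

Definition raiseC (i : 'I_n) (x : letterC) : option letterC :=
  match x with
  | inl k => if k == i.+1 :> nat then Some (inl i) else None
  | inr k => if k == i then
               Some (if insub i.+1 is Some j then inr j else inl i)
             else None
  end.
Definition lowerC (i : 'I_n) (x : letterC) : option letterC :=
  match x with
  | inl k => if k == i then
               Some (if insub i.+1 is Some j then inl j else inr i)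
             else None
  | inr k => if k == i.+1 :> nat then Some (inr i) else None
  end.

Definition typeC := CrystalData wtC_cat raiseC lowerC.

End TypeC.

Section Embedding.
Context (n : nat) (n_gt0 : 0 < n).

Definition top_letter : 'I_n := Ordinal (etrans (ltn_predL n) n_gt0).

Definition letterAC (k : 'I_n.-1) : letterC n := inl (widen_ord (leq_pred n) k).

Definition psi (w : seq 'I_n.-1) : seq (letterC n) :=
  if w is [::] then [::]
  else map letterAC w ++
       [:: inl top_letter; inr top_letter; inl top_letter; inr top_letter].

End Embedding.

(* Main.v *)
Require Import Defs.
From mathcomp Require Import all_boot.
From mathcomp Require Import all_algebra classical_sets functions.
Set Implicit Arguments.
Unset Strict Implicit.
Unset Printing Implicit Defensive.

(** Write t for the word n n̄ n n̄. It has weight 0, an (n-1)-inversion and an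
    n-inversion, and for i < n-1 no letter of it is touched by e_i or f_i. So
    e_(n-1), f_(n-1), e_n, f_n are undefined on every word containing t, while
    for i < n-1 the operators see only the remaining letters, on which they act
    as in type A. Hence x |-> x t identifies the component of u with that of u t,
    and inserting a second copy of t anywhere into u t does not change the
    hypoplactic class. Weights tell the empty word apart. *)

(** * Rewriting along a map of letters *)

Lemma rewrite_first_none (X : Type) (g : X -> option X) (w : seq X) :
  ~~ has (isSome \o g) w -> rewrite_first g w = None.
Proof. by elim: w => //= x w IH; case: (g x) => //= /IH ->. Qed.

Lemma rewrite_first_map (X Y : Type) (p : X -> Y) (g : Y -> option Y)
    (g' : X -> option X) (w : seq X) :
    (forall a, g (p a) = omap p (g' a)) ->
  rewrite_first g (map p w) = omap (map p) (rewrite_first g' w).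
Proof.
move=> gE; elim: w => //= a w ->; rewrite gE.
by case: (g' a) => //=; case: rewrite_first.
Qed.

Lemma rewrite_last_map (X Y : Type) (p : X -> Y) (g : Y -> option Y)
    (g' : X -> option X) (w : seq X) :
    (forall a, g (p a) = omap p (g' a)) ->
  rewrite_last g (map p w) = omap (map p) (rewrite_last g' w).
Proof.
move=> gE; elim: w => //= a w ->; rewrite gE.
by case: rewrite_last => //=; case: (g' a).
Qed.

(** * Inserting words on which no operator acts *)

Section Morphisms.
Context {Q : crystal_data}.
Implicit Types (i : Defs.index Q) (u v w x y t : seq (letter Q)).

Lemma hypoplactic_wt u v : hypoplactic u v -> wt u = wt v.
Proof. by move=> [h [_ <- /(_ u (component_refl u))[->]]]. Qed.

(** Surjectivity is automatic: a word of the component of [v] is reached from [h u = v] by a chain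
    of operators, and the chain lifts step by step because [h] commutes with them. The same
    induction keeps [h] inside that component. *)
Lemma hypoplactic_of_injective_morphism u v (h : seq (letter Q) -> seq (letter Q)) :
    (forall x y, component u x -> component u y -> h x = h y -> x = y) ->
    h u = v ->
    (forall x, component u x ->
      wt (h x) = wt x /\
      forall i, [/\ eps i (h x) = eps i x, phi i (h x) = phi i x,
                    e_op i (h x) = omap h (e_op i x) &
                    f_op i (h x) = omap h (f_op i x)]) ->
  hypoplactic u v.
Proof.
move=> inj hu hP; exists h; split=> //; split.
- move=> x; elim=> [|i a b ab cm E|i a b ab cm E].
  + by rewrite hu; apply: component_refl.
  + have [_ /(_ i)[_ _ ee _]] := hP a ab.
    by apply: (component_e (i := i) cm); rewrite ee E.
  + have [_ /(_ i)[_ _ _ ff]] := hP a ab.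
    by apply: (component_f (i := i) cm); rewrite ff E.
- by move=> x y; rewrite !inE => ux uy; apply: inj.
- move=> y; elim=> [|i a b _ [x xc <-] E|i a b _ [x xc <-] E].
  + by exists u => //; apply: component_refl.
  + move: E; have [_ /(_ i)[_ _ -> _]] := hP x xc.
    case E: e_op => [z|] //= [<-]; exists z => //; exact: component_e xc E.
  + move: E; have [_ /(_ i)[_ _ _ ->]] := hP x xc.
    case E: f_op => [z|] //= [<-]; exists z => //; exact: component_f xc E.
Qed.

Lemma inversion_undefined i w : inversion i w ->
  [/\ eps i w = None, phi i w = None, e_op i w = None & f_op i w = None].
Proof. by rewrite /eps /phi /e_op /f_op => ->. Qed.

Definition inert i t := ~~ has (is_e i) t && ~~ has (is_f i) t.

Lemma inert_inversion i t : inert i t -> inversion i t = false.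
Proof.
case/andP=> /hasPn te _; case: (inversionP i t) => // -[a [x [b [y [c [E _ ey]]]]]].
have yt : y \in t by rewrite E !(mem_cat, inE) eqxx !orbT.
by have := te y yt; rewrite ey.
Qed.

(** The position is a number so that one map serves a whole component: the operators preserve
    lengths. *)
Definition insert_at k t x := take k x ++ t ++ drop k x.

Lemma insert_at_cat t x y : insert_at (size x) t (x ++ y) = x ++ t ++ y.
Proof. by rewrite /insert_at take_size_cat ?drop_size_cat. Qed.

(** An inert [t] adds nothing to the counts and creates no inversion, and the search for the letter
    to rewrite passes over it. *)
Lemma inert_insert i t x y : inert i t ->
  [/\ eps i (x ++ t ++ y) = eps i (x ++ y),
      phi i (x ++ t ++ y) = phi i (x ++ y),
      e_op i (x ++ t ++ y) = omap (insert_at (size x) t) (e_op i (x ++ y)) &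
      f_op i (x ++ t ++ y) = omap (insert_at (size x) t) (f_op i (x ++ y))].
Proof.
move=> it; have nt := inert_inversion it; have /andP[te tf] := it.
have et : count (is_e i) t = 0 by apply/eqP; rewrite -leqn0 leqNgt -has_count.
have ft : count (is_f i) t = 0 by apply/eqP; rewrite -leqn0 leqNgt -has_count.
have invE : inversion i (x ++ t ++ y) = inversion i (x ++ y).
  by rewrite !inversion_cat !has_cat (negbTE te) (negbTE tf) nt /= orbF.
have invE' : inversion i (t ++ y) = inversion i y.
  by rewrite !inversion_cat (negbTE tf) nt /= orbF.
have t_e : e_op i t = None by rewrite /e_op nt rewrite_last_none.
have t_f : f_op i t = None by rewrite /f_op nt rewrite_first_none.
rewrite /eps /phi !count_cat et ft invE; split=> //.
  rewrite (e_op_cat i x) (e_op_cat i x y) invE; case: ifP => // /negbT.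
  rewrite inversion_cat !negb_or => /and3P[_ ny _].
  rewrite has_cat (negbTE te) /= e_op_cat invE' (negbTE ny) t_e.
  case: (has (is_e i) y) => /=.
    by case: (e_op i y) => //= z; rewrite insert_at_cat.
  case E: (e_op i x) => [z|] //=.
  have cz : component x z by apply: component_e (component_refl x) E.
  by rewrite -(size_component cz) insert_at_cat.
rewrite (f_op_cat i x) (f_op_cat i x y) invE; case: ifP => // /negbT.
rewrite inversion_cat !negb_or => /and3P[_ ny _].
rewrite f_op_cat invE' (negbTE ny) (negbTE tf); case: (has (is_f i) x) => /=.
  case E: (f_op i x) => [z|] //=.
  have cz : component x z by apply: component_f (component_refl x) E.
  by rewrite -(size_component cz) insert_at_cat.
by case: (f_op i y) => //= z; rewrite insert_at_cat.
Qed.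

(** No operator is defined on [t]: either an inversion forbids it or there is no letter to
    rewrite. *)
Lemma component_isolated t x :
  (forall i, inversion i t || inert i t) -> component t x -> x = t.
Proof.
move=> tP; elim=> // i a b _ ->.
  case/orP: (tP i) => [/inversion_undefined[_ _ -> _]//|it].
  by rewrite /e_op (inert_inversion it) rewrite_last_none //; case/andP: it.
case/orP: (tP i) => [/inversion_undefined[_ _ _ ->]//|it].
by rewrite /f_op (inert_inversion it) rewrite_first_none //; case/andP: it.
Qed.

(** Throughout the component of [u ++ v ++ t] the final block stays equal to [t]. So for an index
    with an inversion in [t] everything is undefined before and after the insertion; for the other
    indices the new copy is inert. *)
Lemma hypoplactic_insert t u v :
    (forall i, inversion i t || inert i t) -> wt t = 0%R ->
  hypoplactic (u ++ v ++ t) (u ++ t ++ v ++ t).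
Proof.
move=> tP wt0.
apply: (hypoplactic_of_injective_morphism (h := insert_at (size u) t)).
- move=> x y /size_component sx /size_component sy /eqP.
  have su z : size z = size (u ++ v ++ t) -> size (take (size u) z) = size u.
    by move=> sz; rewrite size_takel // sz size_cat leq_addr.
  rewrite /insert_at eqseq_cat ?su // eqseq_cat // eqxx /=.
  by move=> /andP[/eqP E /eqP E'];
  rewrite -(cat_take_drop (size u) x) E E' cat_take_drop.
- exact: insert_at_cat.
move=> x /component_cat[cu /component_cat[_ /(component_isolated tP)]].
set p := take _ x in cu *; set q := drop _ x => qE.
rewrite -(cat_take_drop (size u) x) -/p -/q -(size_component cu).
rewrite insert_at_cat; split; first by rewrite !wt_cat wt0 GRing.add0r.
move=> i; case/orP: (tP i) => [it|]; last exact: inert_insert.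
(* By [qE] the word [q] ends in [t], from which it inherits the inversion. *)
have iq : inversion i q.
  by rewrite -(cat_take_drop (size v) q) inversion_cat qE it orbT.
have i1 : inversion i (p ++ q) by rewrite inversion_cat iq orbT.
have i2 : inversion i (p ++ t ++ q) by rewrite !inversion_cat it orbT.
have [-> -> -> ->] := inversion_undefined i1.
by have [-> -> -> ->] := inversion_undefined i2.
Qed.

End Morphisms.

(** * Embeddings of words that reflect the hypoplactic congruence *)

Section QuasiCrystalEmbedding.
Context {Q R : crystal_data}.
Variables (F : seq (letter Q) -> seq (letter R))
  (G : seq (letter R) -> seq (letter Q)).

Definition intertwines (i : Defs.index Q) (j : Defs.index R) :=
  forall x, [/\ eps j (F x) = eps i x, phi j (F x) = phi i x,
                e_op j (F x) = omap F (e_op i x) &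
                f_op j (F x) = omap F (f_op i x)].

Hypothesis FK : cancel F G.
(** The two weight groups may differ, so weights are compared only through their equality. *)
Hypothesis wtF : forall x y, wt (F x) = wt (F y) <-> wt x = wt y.
Hypothesis indexF : forall i, exists j, intertwines i j.
Hypothesis indexR : forall j,
  (exists i, intertwines i j) \/ (forall x, inversion j (F x)).

Lemma component_embed u x : component u x -> component (F u) (F x).
Proof.
elim=> [|i a b _ IH E|i a b _ IH E]; first exact: component_refl.
  have [j /(_ a)[_ _ ee _]] := indexF i.
  by apply: (component_e (i := j) IH); rewrite ee E.
have [j /(_ a)[_ _ _ ff]] := indexF i.
by apply: (component_f (i := j) IH); rewrite ff E.
Qed.

(** No operator leaves the image of [F]: an index of [R] either comes from [Q] or is undefined on
    the whole image. *)
Lemma component_embedded u y :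
  component (F u) y -> exists2 x, component u x & y = F x.
Proof.
elim=> [|j a b _ [x ux ->] E|j a b _ [x ux ->] E].
- by exists u => //; apply: component_refl.
- case: (indexR j) => [[i /(_ x)[_ _ ee _]]|/(_ x)/inversion_undefined[_ _ ee _]];
    rewrite ee // in E.
  case E' : (e_op i x) E => [z|] //= [<-]; exists z => //.
  exact: component_e ux E'.
- case: (indexR j) => [[i /(_ x)[_ _ _ ff]]|/(_ x)/inversion_undefined[_ _ _ ff]];
    rewrite ff // in E.
  case E' : (f_op i x) E => [z|] //= [<-]; exists z => //.
  exact: component_f ux E'.
Qed.

(** The bijection is conjugated to [F \o h \o G], since [G] inverts [F] on the component of
    [F u]. *)
Lemma hypoplactic_embed u v : hypoplactic u v -> hypoplactic (F u) (F v).
Proof.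
move=> [h [hb hu hP]].
apply: (hypoplactic_of_injective_morphism (h := fun y => F (h (G y)))).
- move=> y y' /component_embedded[x ux ->] /component_embedded[x' ux' ->].
  rewrite !FK => /(can_inj FK) E; congr F.
  by apply: (set_bij_inj hb) E; rewrite inE.
- by rewrite FK hu.
move=> y /component_embedded[x ux ->]; rewrite FK.
have [wx iP] := hP x ux; split=> [|j]; first exact/wtF.
case: (indexR j) => [[i ij]|inv]; last first.
  have [-> -> -> ->] := inversion_undefined (inv x).
  by have [-> -> -> ->] := inversion_undefined (inv (h x)).
have [-> -> -> ->] := ij x; have [-> -> -> ->] := ij (h x).
have [-> -> -> ->] := iP i; split=> //.
  by case: (e_op i x) => //= z; rewrite FK.
by case: (f_op i x) => //= z; rewrite FK.
Qed.

Lemma hypoplactic_embedded u v : hypoplactic (F u) (F v) -> hypoplactic u v.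
Proof.
move=> [h [hb hu hP]].
(* [G] is only a left inverse of [F], but [h (F x)] lies in the component of [F v], hence in the
   image of [F], where [F \o G] is the identity. *)
have FG x : component u x -> F (G (h (F x))) = h (F x).
  move=> /component_embed/(set_bij_homo hb)/component_embedded[z _ ->].
  by rewrite FK.
apply: (hypoplactic_of_injective_morphism (h := fun x => G (h (F x)))).
- move=> x x' ux ux' E; apply: (can_inj FK); apply: (set_bij_inj hb).
  + by rewrite inE; apply: component_embed.
  + by rewrite inE; apply: component_embed.
  + by rewrite -FG // E FG.
- by rewrite hu FK.
move=> x ux; have [wx iP] := hP _ (component_embed ux).
split=> [|i]; first by apply/wtF; rewrite FG.
have [j ij] := indexF i.
have [e1 f1 ee1 ff1] := ij x; have [e2 f2 ee2 ff2] := ij (G (h (F x))).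
have [e3 f3 ee3 ff3] := iP j; rewrite FG // in e2 f2 ee2 ff2.
split; first by rewrite -e2 e3 e1.
- by rewrite -f2 f3 f1.
- apply: (inj_omap (can_inj FK)); rewrite -ee2 ee3 ee1.
  case E: (e_op i x) => [z|] //=; rewrite FG //; exact: component_e ux E.
- apply: (inj_omap (can_inj FK)); rewrite -ff2 ff3 ff1.
  case E: (f_op i x) => [z|] //=; rewrite FG //; exact: component_f ux E.
Qed.

End QuasiCrystalEmbedding.

(** * Type A words followed by the tail, inside type C *)

Section TypeAInTypeC.
Context (n : nat) (n_gt0 : 0 < n).
Local Notation top := (top_letter n_gt0).
Local Notation A := (typeA n.-1).
Local Notation C := (typeC n).

Definition tail : seq (letter C) := [:: inl top; inr top; inl top; inr top].
Definition pad (w : seq (letter A)) : seq (letter C) := map (@letterAC n) w ++ tail.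
(** Since [insub] lands in ['I_n.-1], it rejects the letter n; barred letters are dropped too, so
    the whole tail disappears. *)
Definition unpad (w : seq (letter C)) : seq (letter A) :=
  pmap (fun a : letterC n => if a is inl k then insub (k : nat) else None) w.

Lemma psi_pad w : w != [::] -> psi n_gt0 w = pad w.
Proof. by case: w. Qed.

Lemma padK : cancel pad unpad.
Proof.
move=> w; rewrite /unpad pmap_cat /= insubN -?leqNgt //= cats0.
elim: w => //= a w ->; by rewrite valK.
Qed.

Lemma wt_tail : wt (c := C) tail = 0%R.
Proof.
apply/ffunP => k; rewrite !ffunE /=.
by rewrite add0n GRing.subrr.
Qed.

(** Letters are compared as natural numbers so that the coordinate of n, which is no letter of type
    A, is covered as well. *)
Lemma wt_padE w (k : 'I_n) :
  wt (c := C) (pad w) k = Posz (count (fun a : 'I_n.-1 => a == k :> nat) w).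
Proof.
rewrite /pad wt_cat wt_tail GRing.addr0 ffunE.
rewrite !count_map [X in (_ - Posz X)%R](_ : _ = 0) ?GRing.subr0.
  by congr Posz; apply: eq_count => a.
by elim: w.
Qed.

Lemma wt_pad x y :
  wt (c := C) (pad x) = wt (c := C) (pad y) <-> wt (c := A) x = wt (c := A) y.
Proof.
have wE w (k : 'I_n.-1) : wt (c := A) w k =
    wt (c := C) (pad w) (widen_ord (leq_pred n) k).
  by rewrite wt_padE ffunE.
split=> E; apply/ffunP => k; first by rewrite !wE E.
(* The last coordinate, that of n, has no counterpart in type A; it vanishes on both sides. *)
have [kn|nk] := ltnP k n.-1.
  have -> : k = widen_ord (leq_pred n) (Ordinal kn) by apply: val_inj.
  by rewrite -!wE E.
rewrite !wt_padE; congr Posz.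
have z (w : seq 'I_n.-1) : count (fun a : 'I_n.-1 => a == k :> nat) w = 0.
  apply/eqP; rewrite -leqn0 leqNgt -has_count; apply/hasPn => a _.
  by rewrite neq_ltn (leq_trans (ltn_ord a) nk).
by rewrite !z.
Qed.

(** Indices are shifted by one, so [j] is n-1 or n-2. For index n the inversion is n before n̄; for
    index n-1 it is n̄ before n, in the middle of the tail. *)
Lemma tail_inversion (j : 'I_n) : n.-1 <= j.+1 -> inversion (Q := C) j tail.
Proof.
move=> h; rewrite /inversion /tail /is_e /is_f /= -!val_eqE /=.
have jn : j <= n.-1 by rewrite -ltnS (ltn_predK n_gt0).
have /orP[/eqP E|/eqP E] : (n.-1 == j) || (n.-1 == j.+1).
- by move: h; rewrite leq_eqVlt orbC ltnS [n.-1 == j]eqn_leq jn andbT.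
- by rewrite E eqxx.
- by rewrite E eqxx !andbF.
Qed.

Lemma tail_inert (j : 'I_n) : j.+1 < n.-1 -> inert (Q := C) j tail.
Proof.
move=> h; rewrite /inert /tail /is_e /is_f /= -!val_eqE /=.
by rewrite (gtn_eqF h) (gtn_eqF (ltnW h)).
Qed.

Lemma raise_letterAC (i : Defs.index A) (j : Defs.index C) (a : letter A) :
  i = j :> nat -> raise (c := C) j (letterAC a) =
  omap (@letterAC n) (raise (c := A) i a).
Proof.
move=> ij; rewrite /= /raiseA /= -ij; case: ifP => // _.
have il : i < n.-1 by apply: leq_trans (ltn_ord i) (leq_pred _).
by rewrite insubT /=; congr (Some (inl _)); apply: val_inj.
Qed.

Lemma lower_letterAC (i : Defs.index A) (j : Defs.index C) (a : letter A) :
  i = j :> nat -> lower (c := C) j (letterAC a) =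
  omap (@letterAC n) (lower (c := A) i a).
Proof.
move=> ij; rewrite /= /lowerA -val_eqE /= -ij; case: ifP => // _.
(* The image of the letter stays below n, so both [insub] succeed and neither alphabet falls back on
   its default case. *)
have il : i.+1 < n.-1 by rewrite -ltn_predRL.
have jl : i.+1 < n by apply: leq_trans il (leq_pred _).
by rewrite !insubT /=; congr (Some (inl _)); apply: val_inj.
Qed.

Lemma tail_dichotomy (j : 'I_n) : inversion (Q := C) j tail || inert (Q := C) j tail.
Proof.
by have [/tail_inversion->|/tail_inert->] := leqP n.-1 j.+1; rewrite ?orbT.
Qed.

(** The tail is inert for such an index, so it can be removed by [inert_insert] with an empty right
    part; what remains is a word of unbarred letters on which the operators are those of type A. *)
Lemma pad_intertwines (i : Defs.index A) (j : Defs.index C) :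
  i = j :> nat -> intertwines pad i j.
Proof.
move=> ij x.
have rE a := raise_letterAC a ij; have lE a := lower_letterAC a ij.
have eE a : is_e (Q := C) j (letterAC a) = is_e (Q := A) i a.
  by rewrite /is_e rE; case: raise.
have fE a : is_f (Q := C) j (letterAC a) = is_f (Q := A) i a.
  by rewrite /is_f lE; case: lower.
have jl : j.+1 < n.-1 by rewrite -ij -ltn_predRL.
have [] := inert_insert (Q := C) (map (@letterAC n) x) [::] (tail_inert jl).
rewrite !cats0 -/(pad x) => -> -> -> ->.
have invE : inversion (Q := C) j (map (@letterAC n) x) = inversion (Q := A) i x.
  rewrite /inversion pairwise_map; congr (~~ _); apply: eq_pairwise => a b /=.
  by rewrite eE fE.
(* Inserting the tail at the length of [x] is appending it, for every word as long as [x]. *)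
have padE z : size z = size x ->
    insert_at (size (map (@letterAC n) x)) tail (map (@letterAC n) z) = pad z.
  by move=> zx; rewrite /insert_at size_map take_oversize ?drop_oversize ?cats0 //
    size_map zx.
rewrite /eps /phi /e_op /f_op invE !count_map (eq_count eE) (eq_count fE).
rewrite (rewrite_last_map (g' := raise (c := A) i)) //.
rewrite (rewrite_first_map (g' := lower (c := A) i)) //.
split=> //; case: ifP => // _.
  by case E: rewrite_last => [z|] //=; rewrite padE // (size_rewrite_last E).
by case E: rewrite_first => [z|] //=; rewrite padE // (size_rewrite_first E).
Qed.

Lemma pad_index (i : Defs.index A) : exists j, intertwines pad i j.
Proof.
have ilt : i < n by apply: leq_trans (ltn_ord i) _; rewrite -subn2 leq_subr.
by exists (Ordinal ilt); apply: pad_intertwines.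
Qed.

Lemma index_pad (j : Defs.index C) :
  (exists i, intertwines pad i j) \/ (forall x, inversion j (pad x)).
Proof.
have [h|h] := leqP n.-1 j.+1.
  by right=> x; rewrite inversion_cat tail_inversion // orbT.
have jlt : j < n.-1.-1 by rewrite -ltnS (ltn_predK h).
by left; exists (Ordinal jlt); apply: pad_intertwines.
Qed.

Lemma hypoplactic_pad u v :
  hypoplactic (Q := C) (pad u) (pad v) <-> hypoplactic (Q := A) u v.
Proof.
split; first exact: (hypoplactic_embedded padK wt_pad pad_index index_pad).
exact: (hypoplactic_embed padK wt_pad index_pad).
Qed.

Lemma wtA_eq0 w : wt (c := A) w = wt (c := A) [::] -> w = [::].
Proof.
case: w => // a w /ffunP/(_ a); by rewrite !ffunE /= eqxx.
Qed.

(** [psi] and [pad] differ on the empty word only, and there weights decide: in both types a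
    congruence with the empty word forces the other word to be empty. *)
Lemma hypoplactic_psi u v :
  hypoplactic (Q := C) (psi n_gt0 u) (psi n_gt0 v) <-> hypoplactic (Q := A) u v.
Proof.
have psi0 w : wt (c := C) (psi n_gt0 w) = 0%R <-> w = [::].
  split=> [|->]; last by apply/ffunP => k; rewrite !ffunE.
  have [//|w0] := eqVneq w [::]; rewrite psi_pad // => E.
  (* [pad [::]] is [tail], of weight zero, so a padded word of weight zero comes from the empty
     word. *)
  apply: wtA_eq0; apply/wt_pad.
  by rewrite E -wt_tail.
have [->|u0] := eqVneq u [::].
  split=> [/hypoplactic_wt E|/hypoplactic_wt E].
    suff -> : v = [::] by apply: hypoplactic_refl.
    by apply/psi0; rewrite -E; apply/psi0.
  rewrite (wtA_eq0 (esym E)); exact: hypoplactic_refl.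
have [->|v0] := eqVneq v [::].
  split=> /hypoplactic_wt E; case/eqP: u0; first by apply/psi0; rewrite E; apply/psi0.
  exact: wtA_eq0.
by rewrite !psi_pad //; apply: hypoplactic_pad.
Qed.

(** For nonempty words the two sides are u v t and u t v t, which differ by one inserted copy of the
    tail. *)
Lemma hypoplactic_psi_cat u v :
  hypoplactic (Q := C) (psi n_gt0 (u ++ v)) (psi n_gt0 u ++ psi n_gt0 v).
Proof.
have [->|u0] := eqVneq u [::]; first exact: hypoplactic_refl.
have [->|v0] := eqVneq v [::]; first by rewrite !cats0; apply: hypoplactic_refl.
rewrite !psi_pad //; last by case: (u) u0.
rewrite /pad map_cat -!catA.
exact: (hypoplactic_insert (Q := C)) tail_dichotomy wt_tail.
Qed.

End TypeAInTypeC.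

Theorem theorem9p42 (n : nat) (n_ge3 : 3 <= n) :
  exists Psi : hypo (typeA n.-1) -> hypo (typeC n),
    [/\ forall w : seq 'I_n.-1,
          Psi (hypo_class (Q := typeA n.-1) w) =
          hypo_class (Q := typeC n) (psi (ltnW (ltnW n_ge3)) w),
        monoid_morphism Psi
      & injective Psi].
Proof.
set p := psi _.
pose Psi (x : hypo (typeA n.-1)) := hypo_class (Q := typeC n) (p (repr x)).
(* The forward direction of the congruence equivalence makes the choice of [repr] immaterial; the
   backward one gives injectivity below. *)
have PsiE w : Psi (hypo_class (Q := typeA n.-1) w) = hypo_class (Q := typeC n) (p w).
  by apply/hypo_classP/hypoplactic_psi/hypo_classP; rewrite hypo_class_repr.
exists Psi; split=> //.
- split=> [|x y]; first exact: PsiE.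
  rewrite -(hypo_class_repr x) -(hypo_class_repr y) -[(_ * _)%g]hypo_class_cat !PsiE.
  rewrite -[RHS]hypo_class_cat; apply/hypo_classP; exact: hypoplactic_psi_cat.
- move=> x y /hypo_classP/hypoplactic_psi/hypo_classP.
  by rewrite !hypo_class_repr.
Qed.
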